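(* In the model described in the context, the order process $q_t$ has variance not depending on $t$, and the bullwhip measure satisfies $$ BM=\frac{\operatorname{Var} q_t}{\operatorname{Var} D_t} =\frac{2\sigma_L^2}{n^2m^2}\left(m(1-\rho^n)+\frac{n(1+\rho)}{1-\rho}-\frac{(1+\rho^2)(1-\rho^n)}{(1-\rho)^2}\right)+\frac{2\sigma_L^2\mu_D^2}{\sigma_D^2 m^2}+\left(\frac{2\mu_L^2}{n^2}+\frac{2\mu_L}{n}\right)(1-\rho^n)+1 . $$
   Context: Model. Fix $\mu_D\in\mathbb{R}$, $\rho\in(-1,1)$, and an i.i.d. sequence $(\epsilon_t)_{t\in\mathbb{Z}}$ with $E\epsilon_t=0$, $\operatorname{Var}\epsilon_t=\sigma^2\in(0,\infty)$. The demand $(D_t)_{t\in\mathbb{Z}}$ is the stationary AR(1) process $D_t=\mu_D+\rho(D_{t-1}-\mu_D)+\epsilon_t$; thus $E D_t=\mu_D$ and $\sigma_D^2:=\operatorname{Var}D_t=\sigma^2/(1-\rho^2)$. Fix an integer $L^+\ge 0$. The lead times $(L_t)_{t\in\mathbb{Z}}$ are i.i.d. random variables with values in $\{0,1,\dots,L^+\}$, mean $\mu_L$ and variance $\sigma_L^2$, and the sequence $(L_t)$ is independent of $(\epsilon_t)$ (hence of $(D_t)$). Fix integers $n,m\ge 1$. Forecasts: $\widehat{D}_t=\frac1n\sum_{i=1}^n D_{t-i}$, $\widehat{L}_t=\frac1m\sum_{i=1}^m L_{t-i-L^+}$, and the lead-time-demand forecast $\widehat{D^L_t}=\widehat{L}_t\widehat{D}_t$.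 The order-up-to level is $S_t=\widehat{D^L_t}+\mathit{TNS}$ with $\mathit{TNS}$ a constant not depending on $t$, and the order placed in period $t$ is $q_t=S_t-S_{t-1}+D_{t-1}$, i.e. $q_t=\widehat{L}_t\widehat{D}_t-\widehat{L}_{t-1}\widehat{D}_{t-1}+D_{t-1}$. The bullwhip measure is $BM=\operatorname{Var}q_t/\operatorname{Var}D_t$. *)

(* Defs.v *)
From HB Require Import structures.
From mathcomp Require Import all_boot all_order all_algebra.
From mathcomp Require Import all_classical all_reals all_analysis.
Set Implicit Arguments. Unset Strict Implicit. Unset Printing Implicit Defensive.
Import Order.TTheory GRing.Theory Num.Theory.
Local Open Scope classical_set_scope.
Local Open Scope ring_scope.

Definition mutually_independent {d} {T : measurableType d} {R : realType}
  (P : probability T R) (I : eqType) (X : I -> T -> R) : Prop :=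
  forall (J : seq I) (B : I -> set R), uniq J ->
    (forall i, measurable (B i)) ->
    fine (P (\big[setI/setT]_(i <- J) (X i @^-1` B i)))
      = \prod_(i <- J) fine (P (X i @^-1` B i)).

(* Independence of two families (X i)_{i:I} and (Y j)_{j:J}
   (i.e. of the sigma-algebras they generate). *)
Definition independent_families {d} {T : measurableType d} {R : realType}
  (P : probability T R) (I J : eqType) (X : I -> T -> R) (Y : J -> T -> R) : Prop :=
  forall (s : seq I) (u : seq J) (B : I -> set R) (C : J -> set R),
    (forall i, measurable (B i)) -> (forall j, measurable (C j)) ->
    fine (P ((\big[setI/setT]_(i <- s) (X i @^-1` B i))
             `&` (\big[setI/setT]_(j <- u) (Y j @^-1` C j))))
      = fine (P (\big[setI/setT]_(i <- s) (X i @^-1` B i)))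
        * fine (P (\big[setI/setT]_(j <- u) (Y j @^-1` C j))).

Definition identically_distributed {d} {T : measurableType d} {R : realType}
  (P : probability T R) (X : int -> T -> R) : Prop :=
  forall (t : int) (B : set R), measurable B -> P (X t @^-1` B) = P (X 0 @^-1` B).

Definition eps_L_family {T R : Type} (eps L : int -> T -> R)
  (i : (int + int)%type) : T -> R :=
  match i with inl t => eps t | inr t => L t end.

Definition Dhat {T : Type} {R : realType} (n : nat) (D : int -> T -> R)
  (t : int) : T -> R :=
  fun x => (n%:R)^-1 * \sum_(1 <= i < n.+1) D (t - (i%:Z)) x.

Definition Lhat {T : Type} {R : realType} (m Lp : nat) (L : int -> T -> R)
  (t : int) : T -> R :=
  fun x => (m%:R)^-1 * \sum_(1 <= i < m.+1) L (t - (i%:Z) - (Lp%:Z)) x.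

Definition order_up_to {T : Type} {R : realType} (n m Lp : nat) (TNS : R)
  (D L : int -> T -> R) (t : int) : T -> R :=
  fun x => Lhat m Lp L t x * Dhat n D t x + TNS.

Definition order_q {T : Type} {R : realType} (n m Lp : nat) (TNS : R)
  (D L : int -> T -> R) (t : int) : T -> R :=
  fun x => order_up_to n m Lp TNS D L t x - order_up_to n m Lp TNS D L (t - 1) x
           + D (t - 1) x.

Definition BM_formula {R : realType} (n m : nat) (muD rho s2 muL sL2 : R) : R :=
  let sD2 := s2 / (1 - rho ^+ 2) in
  let nr := (n%:R : R) in let mr := (m%:R : R) in
  (2 * sL2) / (nr ^+ 2 * mr ^+ 2)
    * (mr * (1 - rho ^+ n) + nr * (1 + rho) / (1 - rho)
       - (1 + rho ^+ 2) * (1 - rho ^+ n) / (1 - rho) ^+ 2)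
  + (2 * sL2 * muD ^+ 2) / (sD2 * mr ^+ 2)
  + ((2 * muL ^+ 2) / nr ^+ 2 + (2 * muL) / nr) * (1 - rho ^+ n)
  + 1.

(* Main.v *)
(* Write M, M' for the lead-time forecasts and H, H' for the demand forecasts in
   periods t and t - 1, and Z = D_{t-1}, so that q_t = M H - M' H' + Z up to the
   cancelling constant TNS.  Lead times being independent of demands, the second
   moment of q_t - muD factors into second moments of the pairs (M, M') and
   (H, H', Z - muD).  These are second moments of moving averages of sequences
   with autocovariance v r^k: r = rho for the demand, r = 0 for the lead times.
   For the demand the autocovariance follows from the recursion once D_s is known
   to be uncorrelated with later innovations. *)

Require Import Defs.
From HB Require Import structures.
From mathcomp Require Import all_boot all_order all_algebra.
From mathcomp Require Import all_classical all_reals all_analysis.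
From mathcomp Require Import measurable_realfun ring lra.
Import Order.TTheory GRing.Theory Num.Theory.
Local Open Scope classical_set_scope.
Local Open Scope ring_scope.

(** * Product expectations of independent variables and pairs *)

Section Independence.
Context {d : measure_display} {T : measurableType d} {R : realType}
  (P : probability T R).

Definition independent2 {d1 d2} {T1 : measurableType d1} {T2 : measurableType d2}
    (X : T -> T1) (Y : T -> T2) :=
  forall A B, measurable A -> measurable B ->
    P (X @^-1` A `&` Y @^-1` B) = (P (X @^-1` A) * P (Y @^-1` B))%E.

Lemma independent2C {d1 d2} {T1 : measurableType d1} {T2 : measurableType d2}
    (X : T -> T1) (Y : T -> T2) : independent2 X Y -> independent2 Y X.
Proof. by move=> XY A B mA mB; rewrite setIC XY// muleC. Qed.

Lemma measurable_preimage {d1 d2} {T1 : measurableType d1} {T2 : measurableType d2}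
    (f : T1 -> T2) A : measurable_fun setT f -> measurable A -> measurable (f @^-1` A).
Proof. by move=> mf mA; rewrite -[X in measurable X]setTI; exact: mf. Qed.

Lemma independent2_comp {d1 d2 d3 d4} {T1 : measurableType d1}
    {T2 : measurableType d2} {T3 : measurableType d3} {T4 : measurableType d4}
    (X : T -> T1) (Y : T -> T2) (f : T1 -> T3) (g : T2 -> T4) :
  measurable_fun setT f -> measurable_fun setT g ->
  independent2 X Y -> independent2 (f \o X) (g \o Y).
Proof.
move=> mf mg XY A B mA mB.
exact: (XY (f @^-1` A) (g @^-1` B)
  (measurable_preimage _ _ mf mA) (measurable_preimage _ _ mg mB)).
Qed.

Definition pairRV {d1 d2} {T1 : measurableType d1} {T2 : measurableType d2}
  (X : {mfun T >-> T1}) (Y : {mfun T >-> T2}) (x : T) := (X x, Y x).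

Section pairRV_measurable.
Context {d1 d2 : measure_display} {T1 : measurableType d1} {T2 : measurableType d2}
  (X : {mfun T >-> T1}) (Y : {mfun T >-> T2}).

Let measurable_pairRV : measurable_fun setT (pairRV X Y).
Proof. by apply/measurable_fun_pairP; split; exact: measurable_funPT. Qed.

HB.instance Definition _ := isMeasurableFun.Build _ _ _ _ (pairRV X Y) measurable_pairRV.
End pairRV_measurable.

(* Both sides are finite measures in [S] that agree on measurable rectangles. *)
Lemma independent_pair_event {d1 d2} {T1 : measurableType d1} {T2 : measurableType d2}
    (X : {mfun T >-> T1}) (Y : {mfun T >-> T2}) (E : set T) :
  measurable E ->
  (forall A B, measurable A -> measurable B ->
    P (X @^-1` A `&` Y @^-1` B `&` E) = (P (X @^-1` A `&` Y @^-1` B) * P E)%E) ->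
  forall S, measurable S ->
    P (pairRV X Y @^-1` S `&` E) = (P (pairRV X Y @^-1` S) * P E)%E.
Proof.
move=> mE XYE S mS.
have mZ : measurable_fun setT (pairRV X Y) by exact: measurable_funPT.
(* The measurability proof needed by this measure becomes an argument of [m1]. *)
pose m1 : {measure set _ -> \bar R} := pushforward (mrestr P mE) (pairRV X Y).
have E0 : (0 <= fine (P E))%R by exact: fine_ge0.
pose m2 : {measure set _ -> \bar R} := mscale (NngNum E0) (distribution P (pairRV X Y)).
pose C : set (set (T1 * T2)) :=
  [set A `*` B | A in measurable & B in measurable].
have -> : P (pairRV X Y @^-1` S `&` E) = m1 mZ S by [].
have -> : (P (pairRV X Y @^-1` S) * P E = m2 S)%E.
  by rewrite /m2 /= /mscale /= muleC fineK// fin_num_measure.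
apply: (@measure_unique _ _ _ C (fun=> setT) _ _ _ _ (m1 mZ) m2 _ _ S) => //.
- exact: measurable_prod_measurableType.
- move=> _ _ [A mA [B mB <-]] [A' mA' [B' mB' <-]].
  by rewrite -setXI; exists (A `&` A'); [exact: measurableI|];
    exists (B `&` B') => //; exact: measurableI.
- by move=> _; exists setT => //; exists setT => //; rewrite setXTT.
- by apply/seteqP; split => // x _; exists 0%N.
- move=> _ [A mA [B mB <-]].
  rewrite /m2 /= /mscale /= fineK ?fin_num_measure// muleC.
  exact: XYE.
- move=> k; rewrite /m1 /= /pushforward /mrestr preimage_setT setTI.
  by rewrite ltey_eq fin_num_measure.
Qed.


(** One pair at a time: [independent_pair_event] extends the factorisation from boxes to general
    sets in the [X] pair against a fixed [Y] box, then in the [Y] pair against the event so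
    obtained. *)
Lemma independent2_pairs {d1 d2 d3 d4} {T1 : measurableType d1}
    {T2 : measurableType d2} {T3 : measurableType d3} {T4 : measurableType d4}
    (X1 : {mfun T >-> T1}) (X2 : {mfun T >-> T2})
    (Y1 : {mfun T >-> T3}) (Y2 : {mfun T >-> T4}) :
  (forall A1 A2 B1 B2,
    measurable A1 -> measurable A2 -> measurable B1 -> measurable B2 ->
    P ((X1 @^-1` A1 `&` X2 @^-1` A2) `&` (Y1 @^-1` B1 `&` Y2 @^-1` B2)) =
      (P (X1 @^-1` A1 `&` X2 @^-1` A2) * P (Y1 @^-1` B1 `&` Y2 @^-1` B2))%E) ->
  independent2 (pairRV X1 X2) (pairRV Y1 Y2).
Proof.
move=> XY A B mA mB; rewrite setIC muleC.
apply: independent_pair_event => //; first exact: measurable_preimage.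
move=> B1 B2 mB1 mB2; rewrite setIC muleC.
apply: independent_pair_event => //.
  by apply: measurableI; exact: measurable_preimage.
by move=> A1 A2 mA1 mA2; exact: XY.
Qed.

(** The joint law is the product of the marginals, since both agree on rectangles; Tonelli then
    gives integrability of the product and Fubini its factorisation. *)
Lemma independent2_mul (X Y : {mfun T >-> R}) : independent2 X Y ->
  (X : T -> R) \in Lfun P 1%E -> (Y : T -> R) \in Lfun P 1%E ->
  (X \* Y) \in Lfun P 1%E /\ 'E_P[X \* Y]%E = ('E_P[X] * 'E_P[Y])%E.
Proof.
move=> XY /Lfun1_integrable iX /Lfun1_integrable iY.
pose PX : probability _ R := distribution P X.
pose PY : probability _ R := distribution P Y.
pose PXY : probability _ R := distribution P (pairRV X Y).
have PXYE A : measurable A -> (PX \x PY)%E A = PXY A.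
  apply: product_measure_unique => A1 A2 mA1 mA2.
  exact: XY.
pose f (z : R * R) := (z.1 * z.2)%:E.
have mf : measurable_fun [set: R * R] f.
  by apply/measurable_EFinP; exact: measurable_funM.
have iPX : PX.-integrable setT (EFin : R -> \bar R).
  by apply: integrable_pushforward => //.
have iPY : PY.-integrable setT (EFin : R -> \bar R).
  by apply: integrable_pushforward => //.
have int_f : (PX \x PY)%E.-integrable setT f.
  apply/integrable12ltyP => //.
  pose c := (\int[PY]_y `|y%:E|)%E.
  have mabs (g : R -> \bar R) : measurable_fun setT g ->
      measurable_fun setT (fun x => `|g x|%E) by exact: measurableT_comp.
  (* The inner integral is [|x|] times the constant [c], so the double integral is a product of two
     finite absolute moments. *)
  have -> : (\int[PX]_x \int[PY]_y `|f (x, y)| = \int[PX]_x (`|x%:E| * c))%E.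
    apply: eq_integral => x _.
    rewrite /c -ge0_integralZl//; last exact: mabs.
    by apply: eq_integral => y _; rewrite /f /= normrM.
  rewrite ge0_integralZr//; [|exact: mabs|exact: integral_ge0].
  apply: lte_mul_pinfty; [exact: integral_ge0| |].
  - rewrite ge0_fin_numE; last exact: integral_ge0.
    by case/integrableP : iPX.
  - by case/integrableP : iPY.
have iPXY : PXY.-integrable setT f.
  apply/integrableP; split => //.
  case/integrableP : int_f => _; apply: le_lt_trans.
  rewrite [leRHS](eq_measure_integral PXY)// => A mA _.
  exact: PXYE.
have iXY : P.-integrable setT (EFin \o (X \* Y)).
  apply/integrableP; split.
    by apply/measurable_EFinP; exact: measurable_funM.
  case/integrableP : iPXY => _; rewrite ge0_integral_distribution//.
  exact: measurableT_comp.
split; first exact/Lfun1_integrable.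
rewrite !unlock.
transitivity (\int[PXY]_z f z)%E; first by rewrite integral_distribution.
transitivity (\int[(PX \x PY)%E]_z f z)%E.
  by apply: eq_measure_integral => A mA _; exact/esym/PXYE.
rewrite -integral12_prod_meas1// /fubini_F.
have -> : (\int[P]_w (Y w)%:E = \int[PY]_y y%:E)%E.
  by rewrite integral_distribution.
have -> : (\int[P]_w (X w)%:E = \int[PX]_x x%:E)%E.
  by rewrite integral_distribution.
pose c := (\int[PY]_y y%:E)%E.
have c_fin : c \is a fin_num by exact: integrable_fin_num.
rewrite -/c -(fineK c_fin) -integralZr//.
apply: eq_integral => x _ /=; rewrite fineK// /c -integralZl//.
Qed.

End Independence.

Ltac L1_closed :=
  repeat match goal with
  | |- is_true ((_ - _) \in _) => apply: rpredB
  | |- is_true ((_ + _) \in _) => apply: rpredD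
  | |- is_true ((_ *: _) \in _) => apply: rpredZ
  end; done.

(** * Expectation as a real linear functional on integrable variables *)

Section LinearExpectation.
Context {d : measure_display} {T : measurableType d} {R : realType}
  (P : probability T R).
Implicit Types (f g U V : T -> R) (X : int -> T -> R).

Local Notation L1 := (Lfun P 1%E).
Local Notation Ex f := (fine ('E_P[f])%E).

(** Taking [fine] makes expectations real, so that [ring] applies to them; integrability ensures
    that no infinite value is replaced by a default. *)
Lemma expectation_linear (a : R) f g : f \in L1 -> g \in L1 ->
  Ex (a *: f + g) = a * Ex f + Ex g.
Proof.
move=> f1 g1; have af1 : a *: f \in L1 by rewrite rpredZ.
rewrite (_ : 'E_P[a *: f + g] = 'E_P[a *: f] + 'E_P[g])%E; last exact: expectationD.
rewrite fineD ?expectation_fin_num//; congr (_ + _).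
rewrite -[a]/(fine a%:E) -fineM ?expectation_fin_num// -expectationZl//.
by congr (fine 'E_P[_]%E); apply/funext => x /=; rewrite mulrC.
Qed.

Lemma Ex0 : Ex (0 : T -> R) = 0.
Proof. by rewrite (expectation_cst P 0). Qed.

Lemma ExD f g : f \in L1 -> g \in L1 -> Ex (f + g) = Ex f + Ex g.
Proof. by move=> f1 g1; rewrite -[in LHS](scale1r f) expectation_linear// mul1r. Qed.

Lemma ExZ (a : R) f : f \in L1 -> Ex (a *: f) = a * Ex f.
Proof.
by move=> f1; rewrite -[in LHS](addr0 (a *: f)) expectation_linear ?rpred0// Ex0 addr0.
Qed.

Lemma ExB f g : f \in L1 -> g \in L1 -> Ex (f - g) = Ex f - Ex g.
Proof.
move=> f1 g1; rewrite -scaleN1r addrC expectation_linear//; ring.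
Qed.

(** Integrability is included so that the predicate is stable under linear combinations in either
    argument. *)
Definition uncorrelated U V :=
  [/\ U \in L1, V \in L1, U * V \in L1 & Ex (U * V) = Ex U * Ex V].

Definition linear_pred (C : (T -> R) -> Prop) :=
  C 0 /\ forall (a : R) f g, C f -> C g -> C (a *: f + g).

Lemma linear_pred_L1 : linear_pred (fun f => f \in L1).
Proof. by split=> [|a f g f1 g1]; rewrite ?rpred0// rpredD// rpredZ. Qed.

Lemma scale_mul_fct (a : R) f g : (a *: f) * g = a *: (f * g).
Proof. by apply/funext => x; exact/esym/mulrA. Qed.

Lemma linear_pred_uncorrelated V : V \in L1 -> linear_pred (uncorrelated^~ V).
Proof.
move=> V1; split=> [|a f g [f1 _ fV1 fV] [g1 _ gV1 gV]].
  by split; rewrite ?mul0r ?rpred0// Ex0 mul0r.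
have E1 : (a *: f + g) * V = a *: (f * V) + g * V.
  by rewrite mulrDl scale_mul_fct.
split=> //; rewrite ?E1 ?rpredD ?rpredZ//.
by rewrite !expectation_linear// fV gV; ring.
Qed.

Lemma uncorrelatedC U V : uncorrelated U V -> uncorrelated V U.
Proof. by case=> U1 V1 UV1 UV; split=> //; rewrite mulrC// UV mulrC. Qed.

Definition partial_sum (n : nat) X (t : int) : T -> R :=
  \sum_(1 <= i < n.+1) X (t - i%:Z).

Lemma partial_sum0 X t : partial_sum 0 X t = 0.
Proof. by rewrite /partial_sum big_geq. Qed.

Lemma partial_sumS n X t :
  partial_sum n.+1 X t = X (t - n.+1%:Z) + partial_sum n X t.
Proof. by rewrite /partial_sum big_nat_recr//= addrC. Qed.

Lemma DhatE n X t : Dhat n X t = n%:R^-1 *: partial_sum n X t.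
Proof.
by apply/funext => x; rewrite /Dhat /partial_sum /GRing.scale/= fct_sumE.
Qed.

(** Properties of single samples pass to forecasts, which are linear combinations of them; the
    factor [g] lets a product be treated one argument at a time. *)
Lemma linear_pred_Dhat (C : (T -> R) -> Prop) n X t g : linear_pred C ->
  (forall i, C (X i * g)) -> C (Dhat n X t * g).
Proof.
move=> [C0 Clin] CX; rewrite DhatE scale_mul_fct -[X in C X]addr0.
apply: (Clin) => //; elim: n => [|n IHn]; first by rewrite partial_sum0 mul0r.
by rewrite partial_sumS mulrDl -[X in C (X + _)]scale1r; apply: Clin.
Qed.

(** Telescoping: moving the window by one period admits one sample and drops one. *)
Lemma partial_sum_shift n X t :
  partial_sum n X t - partial_sum n X (t - 1) = X (t - 1) - X (t - 1 - n%:Z).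
Proof.
elim: n => [|n IHn]; first by rewrite !partial_sum0 !subr0 subrr.
rewrite !partial_sumS opprD addrACA IHn.
have -> : t - n.+1%:Z = t - 1 - n%:Z by rewrite -addn1 PoszD opprD addrA addrAC.
by rewrite addrC addrA subrK.
Qed.

End LinearExpectation.

(** * Second moments of moving averages under a geometric autocovariance *)

Section MovingAverage.
Context {d : measure_display} {T : measurableType d} {R : realType}
  (P : probability T R) (X : int -> T -> R) (mu v r : R).

Local Notation L1 := (Lfun P 1%E).
Local Notation Ex f := (fine ('E_P[f])%E).

Hypothesis X1 : forall t, X t \in L1.
Hypothesis X2 : forall s t, X s * X t \in L1.
Hypothesis EX : forall t, Ex (X t) = mu.
Hypothesis EXX : forall t (k : nat), Ex (X t * X (t - k%:Z)) = mu ^+ 2 + v * r ^+ k.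

Let S n t := partial_sum n X t.
Let geom n := \sum_(i < n) r ^+ i.

Let expE n : r ^+ n = 1 - (1 - r) * geom n.
Proof. by rewrite /geom -[1 - r]opprB mulNr -subrX1; ring. Qed.

Let geomS n : geom n.+1 = geom n + r ^+ n.
Proof. by rewrite /geom big_ord_recr. Qed.

Let S1 n t : S n t \in L1.
Proof.
elim: n => [|n IHn]; first by rewrite /S partial_sum0 rpred0.
by rewrite /S partial_sumS rpredD.
Qed.

Let SX1 n s t : S n s * X t \in L1.
Proof.
elim: n => [|n IHn]; first by rewrite /S partial_sum0 mul0r rpred0.
by rewrite /S partial_sumS mulrDl rpredD.
Qed.

Let SS1 n s m t : S n s * S m t \in L1.
Proof.
elim: n => [|n IHn]; first by rewrite /S partial_sum0 mul0r rpred0.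
by rewrite /S partial_sumS mulrDl rpredD// mulrC; exact: SX1.
Qed.

Let ES n t : Ex (S n t) = n%:R * mu.
Proof.
elim: n => [|n IHn]; first by rewrite /S partial_sum0 Ex0 mul0r.
by rewrite /S partial_sumS ExD//; [rewrite IHn EX -natr1; ring|exact: S1].
Qed.

(** The lag [j] is general because, once the oldest sample is split off, the remaining window lies
    one period further from the fixed sample. *)
Let ES_past n t (j : nat) :
  Ex (S n t * X (t - n%:Z - j%:Z)) = n%:R * mu ^+ 2 + v * r ^+ j * geom n.
Proof.
elim: n j => [|n IHn] j.
  by rewrite /S partial_sum0 mul0r Ex0 /geom big_ord0; ring.
rewrite /S partial_sumS mulrDl ExD//; last exact: SX1.
rewrite EXX.
have -> : t - n.+1%:Z - j%:Z = t - n%:Z - j.+1%:Z.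
  by rewrite -[n.+1]addn1 -[j.+1]addn1 !PoszD; ring.
rewrite IHn geomS -natr1 (exprS r _).
(* By [expE], [geom n + r ^+ n] equals [1 + r * geom n]: the split-off sample gives the 1, the
   remaining window the other term. *)
rewrite (expE n); ring.
Qed.

Let ES_recent n t : Ex (S n t * X (t - 1)) = n%:R * mu ^+ 2 + v * geom n.
Proof.
elim: n => [|n IHn]; first by rewrite /S partial_sum0 mul0r Ex0 /geom big_ord0; ring.
rewrite /S partial_sumS mulrDl ExD//; last exact: SX1.
(* [EXX] expects the later index first, hence the commutation. *)
rewrite IHn mulrC (_ : t - n.+1%:Z = t - 1 - n%:Z); last first.
  by rewrite -addn1 PoszD opprD addrA addrAC.
rewrite EXX geomS -natr1; ring.
Qed.

(** With the denominator [(1 - r) ^+ 2] cleared, each induction step is a polynomial identity; the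
    cross term with the oldest sample is [ES_past] at [j = 1]. *)
Let ESS n t : (1 - r) ^+ 2 * Ex (S n t * S n t) =
  (1 - r) ^+ 2 * (n%:R * mu) ^+ 2 + v * (n%:R * (1 - r ^+ 2) - 2 * r * (1 - r ^+ n)).
Proof.
elim: n => [|n IHn]; first by rewrite /S partial_sum0 mul0r Ex0; ring.
have -> : S n.+1 t * S n.+1 t =
    X (t - n.+1%:Z) * X (t - n.+1%:Z) + S n t * X (t - n.+1%:Z)
    + S n t * X (t - n.+1%:Z) + S n t * S n t.
  rewrite /S partial_sumS; move: (X _) (partial_sum _ _ _) => f g.
  by rewrite mulrDl !mulrDr [f * g]mulrC !addrA.
rewrite !ExD ?rpredD//.
have XX : Ex (X (t - n.+1%:Z) * X (t - n.+1%:Z)) = mu ^+ 2 + v.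
  by have := EXX (t - n.+1%:Z) 0; rewrite subr0 expr0 mulr1.
have SX : Ex (S n t * X (t - n.+1%:Z)) = n%:R * mu ^+ 2 + v * r * geom n.
  by rewrite -[n.+1]addn1 PoszD opprD addrA ES_past expr1.
rewrite XX SX !mulrDr IHn -natr1 (exprS r n) (expE n); ring.
Qed.

Lemma mean_Dhat n t : (0 < n)%N -> Ex (Dhat n X t) = mu.
Proof.
move=> n0; rewrite DhatE ExZ ?ES//; last exact: S1.
by rewrite mulKf// pnatr_eq0 -lt0n.
Qed.

Lemma Dhat_sqr n t : (0 < n)%N -> r != 1 ->
  Ex (Dhat n X t * Dhat n X t) =
  mu ^+ 2 + v * (n%:R * (1 - r ^+ 2) - 2 * r * (1 - r ^+ n)) / (n%:R * (1 - r)) ^+ 2.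
Proof.
move=> n0 r1; have nN0 : n%:R != 0 :> R by rewrite pnatr_eq0 -lt0n.
have r1N0 : 1 - r != 0 by rewrite subr_eq0 eq_sym.
rewrite DhatE scale_mul_fct mulrC scale_mul_fct !ExZ ?rpredZ//; try exact: SS1.
have -> : Ex (partial_sum n X t * partial_sum n X t) =
    ((1 - r) ^+ 2 * (n%:R * mu) ^+ 2 +
      v * (n%:R * (1 - r ^+ 2) - 2 * r * (1 - r ^+ n))) / (1 - r) ^+ 2.
  by rewrite -(ESS n t) mulrAC divff ?mul1r// expf_neq0.
by field; rewrite r1N0.
Qed.

(** By [partial_sum_shift], only the entering and the leaving sample matter, whatever the factor
    [g]. *)
Let Dhat_shift_mul n t g : (0 < n)%N -> (forall i, X i * g \in L1) ->
  Ex (Dhat n X t * g) - Ex (Dhat n X (t - 1) * g) =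
  n%:R^-1 * (Ex (X (t - 1) * g) - Ex (X (t - 1 - n%:Z) * g)).
Proof.
move=> n0 Xg1.
have Sg1 s : partial_sum n X s * g \in L1.
  elim: (n) => [|k IHk]; first by rewrite partial_sum0 mul0r rpred0.
  by rewrite partial_sumS mulrDl rpredD.
rewrite !DhatE !scale_mul_fct !ExZ// -mulrBr; congr (_ * _).
by rewrite -!ExB// -!mulrBl partial_sum_shift.
Qed.

Lemma Dhat_recent_diff n t : (0 < n)%N ->
  Ex (Dhat n X t * X (t - 1)) - Ex (Dhat n X (t - 1) * X (t - 1)) =
  v * (1 - r ^+ n) / n%:R.
Proof.
move=> n0; rewrite Dhat_shift_mul// [X (_ - n%:Z) * _]mulrC EXX.
have -> : Ex (X (t - 1) * X (t - 1)) = mu ^+ 2 + v.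
  by have := EXX (t - 1) 0; rewrite subr0 expr0 mulr1.
ring.
Qed.

(** No double sum is recomputed: shifting one factor leaves the forecast paired with its newest
    sample and with the sample just older than its window. *)
Lemma Dhat_consecutive n t : (0 < n)%N ->
  Ex (Dhat n X t * Dhat n X (t - 1)) =
  Ex (Dhat n X t * Dhat n X t) - v * (1 - r ^+ n) / n%:R ^+ 2.
Proof.
move=> n0.
have XS1 i : X i * Dhat n X t \in L1.
  by rewrite DhatE mulrC scale_mul_fct rpredZ//; exact: SX1.
have key : Ex (Dhat n X t * Dhat n X t) - Ex (Dhat n X (t - 1) * Dhat n X t) =
    v * (1 - r ^+ n) / n%:R ^+ 2.
  rewrite Dhat_shift_mul// DhatE [X (t - 1) * _]mulrC [X (t - 1 - _) * _]mulrC.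
  rewrite !scale_mul_fct !ExZ; try exact: SX1.
  by rewrite ES_recent [t - 1 - _]addrAC (ES_past n t 1) (expE n); field; rewrite pnatr_eq0 -lt0n.
by rewrite -key [Dhat n X (t - 1) * _]mulrC; ring.
Qed.

End MovingAverage.

(** * Vanishing under a geometric bound *)

Section GeometricBound.
Import numFieldNormedType.Exports.
Context {R : realType}.

Lemma geometric_bound_eq0 (r a C : R) : -1 < r < 1 ->
  (forall k : nat, `|a| <= `|r| ^+ k * C) -> a = 0.
Proof.
move=> r1 aC; apply/eqP; rewrite -normr_le0.
have : (fun k : nat => `|r| ^+ k * C) @ \oo --> (0 : R).
  rewrite -[0 : R](mul0r C); apply: cvgMl; apply: cvg_expr.
  by rewrite normr_id ltr_norml.
move=> cv; rewrite -(cvg_lim _ cv)//; apply: limr_ge; first by apply/cvg_ex; exists 0.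
by near=> k; exact: aC.
Unshelve. all: by end_near. Qed.

End GeometricBound.

(** * Moments of the stationary AR(1) process *)

Section AutoregressiveMoments.
Context {d : measure_display} {T : measurableType d} {R : realType}
  (P : probability T R) (X eps : int -> T -> R) (mu r s2 M : R).

Local Notation L1 := (Lfun P 1%E).
Local Notation Ex f := (fine ('E_P[f])%E).

Hypothesis r1 : -1 < r < 1.
Hypothesis X_rec : forall t, X t = r *: X (t - 1) + (eps t + cst ((1 - r) * mu)).
Hypothesis X1 : forall t, X t \in L1.
Hypothesis e1 : forall t, eps t \in L1.
Hypothesis X2 : forall s t, X s * X t \in L1.
Hypothesis Xe : forall s t, X s * eps t \in L1.
Hypothesis e2 : forall s t, eps s * eps t \in L1.
Hypothesis Eeps : forall t, Ex (eps t) = 0.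
Hypothesis Eee : forall s t, s != t -> Ex (eps s * eps t) = 0.
Hypothesis Ees : forall t, Ex (eps t * eps t) = s2.
Hypothesis EXconst : forall t, Ex (X t) = Ex (X 0).
Hypothesis EXXconst : forall t, Ex (X t * X t) = M.

Let r_neq1 : 1 - r != 0.
Proof. by rewrite subr_eq0 eq_sym; case/andP: r1 => _ /lt_eqF ->. Qed.

Let cst1 c : cst c \in L1. Proof. exact: Lfun_cst. Qed.

(** Stationarity turns the recursion into a fixed-point equation for the mean, solvable because [r]
    differs from 1. *)
Lemma AR1_mean t : Ex (X t) = mu.
Proof.
have := EXconst 1.
rewrite (X_rec 1) expectation_linear ?rpredD// ExD// Eeps expectation_cst/= add0r.
rewrite EXconst => E0; rewrite EXconst; apply: (mulfI r_neq1).
by rewrite [LHS]mulrBl mul1r -[X in X - _]E0; ring.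
Qed.

Let cstM c f : cst c * f = c *: f :> (T -> R).
Proof. by []. Qed.

Let noise_rec (j : nat) t : Ex (X t * eps (t + j.+1%:Z)) =
  r * Ex (X (t - 1) * eps (t + j.+1%:Z)).
Proof.
rewrite {1}X_rec mulrDl scale_mul_fct mulrDl cstM expectation_linear ?rpredD ?rpredZ//.
rewrite ExD ?rpredZ// ExZ// Eeps Eee; first by ring.
by rewrite -subr_eq0 opprD addrA subrr sub0r oppr_eq0.
Qed.

(** The square of [X s + a *: eps t] has nonnegative expectation; [a = 1] and [a = -1] give the two
    halves of a bound that is uniform in both indices. *)
Let noise_bound s t : `|Ex (X s * eps t)| <= (M + s2) / 2.
Proof.
have sq (a : R) : a ^+ 2 = 1 -> 0 <= M + s2 + 2 * a * Ex (X s * eps t).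
  move=> a1.
  have <- : Ex ((X s + a *: eps t) * (X s + a *: eps t)) =
      M + s2 + 2 * a * Ex (X s * eps t).
    have -> : (X s + a *: eps t) * (X s + a *: eps t) =
        X s * X s + ((2 * a) *: (X s * eps t) + a ^+ 2 *: (eps t * eps t)).
      by apply/funext => x; rewrite !fctE /GRing.scale /=; ring.
    by rewrite a1 scale1r ExD ?rpredD ?rpredZ// expectation_linear// EXXconst Ees; ring.
  apply: fine_ge0; apply: expectation_ge0 => x; exact: sqr_ge0.
have := sq 1; have := sq (-1); rewrite sqrrN expr1n => /(_ erefl) h1 /(_ erefl) h2.
by rewrite ler_norml; apply/andP; split; lra.
Qed.

(* Unrolling the recursion [k] times multiplies the correlation with a future
   innovation by [r ^+ k], while stationarity keeps that correlation bounded. *)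
Lemma AR1_noise t (j : nat) : Ex (X t * eps (t + j.+1%:Z)) = 0.
Proof.
apply: (@geometric_bound_eq0 _ r _ ((M + s2) / 2)) => // k.
have -> : Ex (X t * eps (t + j.+1%:Z)) =
    r ^+ k * Ex (X (t - k%:Z) * eps (t + j.+1%:Z)).
  elim: k => [|k IHk]; first by rewrite expr0 mul1r subr0.
  rewrite IHk exprSr -mulrA; congr (_ * _).
  (* The innovation lies [k + j + 1] periods after [t - k], which fixes the offset [k + j]. *)
  have := noise_rec (k + j) (t - k%:Z).
  have -> : t - k%:Z + (k + j).+1%:Z = t + j.+1%:Z.
    by rewrite -addnS PoszD addrA subrK.
  by move=> ->; rewrite -[k.+1]addn1 PoszD opprD addrA.
by rewrite normrM normrX ler_wpM2l// exprn_ge0.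
Qed.

Let noise_prev t : Ex (X (t - 1) * eps t) = 0.
Proof. by have := AR1_noise (t - 1) 0; rewrite subrK. Qed.

(** [M] is a raw second moment. When the recursion is squared, the product of the previous state and
    the innovation has mean zero, which leaves a linear equation for [M]. *)
Lemma AR1_variance : (1 - r ^+ 2) * (M - mu ^+ 2) = s2.
Proof.
pose c := (1 - r) * mu.
have : Ex (X 0 * X 0) = r ^+ 2 * M + 2 * r * c * mu + s2 + c ^+ 2.
  rewrite (X_rec 0) -/c.
  have -> : (r *: X (0 - 1) + (eps 0 + cst c)) * (r *: X (0 - 1) + (eps 0 + cst c)) =
     r ^+ 2 *: (X (0 - 1) * X (0 - 1)) + ((2 * r) *: (X (0 - 1) * eps 0) +
     ((2 * r * c) *: X (0 - 1) + ((2 * c) *: eps 0 + (eps 0 * eps 0 + cst (c ^+ 2))))).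
    by apply/funext => x; rewrite !fctE /GRing.scale /=; ring.
  do 4 (rewrite expectation_linear; [|L1_closed|L1_closed]).
  rewrite ExD// AR1_mean Eeps noise_prev Ees EXXconst expectation_cst/=; ring.
rewrite EXXconst => EM.
have -> : s2 = M - (r ^+ 2 * M + 2 * r * c * mu + c ^+ 2) by rewrite {1}EM; ring.
by rewrite /c; ring.
Qed.

(** The recursion is applied to the later factor; its innovation is uncorrelated with the earlier
    one by [AR1_noise], so each further lag multiplies the covariance by [r]. *)
Lemma AR1_autocovariance t (k : nat) :
  Ex (X t * X (t - k%:Z)) = mu ^+ 2 + (M - mu ^+ 2) * r ^+ k.
Proof.
elim: k t => [|k IHk] t; first by rewrite subr0 EXXconst; ring.
have -> : t - k.+1%:Z = t - 1 - k%:Z by rewrite -addn1 PoszD opprD addrA addrAC.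
have e0 : Ex (X (t - 1 - k%:Z) * eps t) = 0.
  have := AR1_noise (t - 1 - k%:Z) k.
  have -> // : t - 1 - k%:Z + k.+1%:Z = t.
  by rewrite -addn1 PoszD addrA subrK subrK.
have eX1 : eps t * X (t - 1 - k%:Z) \in L1 by rewrite mulrC.
rewrite {1}X_rec mulrDl scale_mul_fct mulrDl cstM expectation_linear ?rpredD ?rpredZ//.
rewrite ExD ?rpredZ// ?ExZ// IHk AR1_mean [eps t * _]mulrC e0 (exprS r k); ring.
Qed.

End AutoregressiveMoments.

(** * From independence to uncorrelated samples and forecasts *)

Section Reduction.
Context {d : measure_display} {T : measurableType d} {R : realType}
  (P : probability T R).
Implicit Types (f g U V : T -> R).

Local Notation L1 := (Lfun P 1%E).
Local Notation Ex f := (fine ('E_P[f])%E).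

Lemma measurable_L1 f : f \in L1 -> measurable_fun setT f.
Proof. by move=> /Lfun1_integrable/integrableP[/measurable_EFinP]. Qed.

Lemma bounded_L1 f (C : R) : measurable_fun setT f -> (forall x, `|f x| <= C) ->
  f \in L1.
Proof.
move=> mf fC; apply/Lfun1_integrable.
apply: measurable_bounded_integrable => //.
  by rewrite ltey_eq fin_num_measure.
by exists C; split; [exact: num_real|move=> y Cy x _; exact: le_trans (fC x) (ltW Cy)].
Qed.

Lemma independent2_uncorrelated U V :
  independent2 P U V -> U \in L1 -> V \in L1 -> uncorrelated P U V.
Proof.
move=> UV U1 V1.
pose U' : {mfun T >-> R} := HB.pack U (isMeasurableFun.Build _ _ _ _ U (measurable_L1 _ U1)).
pose V' : {mfun T >-> R} := HB.pack V (isMeasurableFun.Build _ _ _ _ V (measurable_L1 _ V1)).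
have [UV1 E] := independent2_mul P U' V' UV U1 V1.
split=> //.
transitivity (fine ('E_P[U] * 'E_P[V])%E); first by congr fine; exact: E.
by rewrite fineM// expectation_fin_num.
Qed.

Lemma second_moment f (s : R) : f \in L1 -> f * f \in L1 -> 'V_P[f] = s%:E ->
  Ex (f * f) = Ex f ^+ 2 + s.
Proof.
move=> f1 ff1; rewrite /variance covarianceE// => /(congr1 fine).
rewrite fineB ?fin_numM ?expectation_fin_num// fineM ?expectation_fin_num//=.
by move=> <-; rewrite expr2 addrC subrK.
Qed.

(** The form as an intersection also covers [i = j], where the box is the intersection of [A] and
    [B]. *)
Let pair_boxes (I : eqType) (i j : I) (A B : set R) (k : I) : set R :=
  (if k == i then A else setT) `&` (if k == j then B else setT).

Let measurable_pair_boxes (I : eqType) (i j : I) (A B : set R) k :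
  measurable A -> measurable B -> measurable (pair_boxes I i j A B k).
Proof. by move=> mA mB; apply: measurableI; case: ifP. Qed.

Let pair_boxesE (I : eqType) (X : I -> T -> R) i j (A B : set R) :
  \big[setI/setT]_(k <- [:: i; j]) (X k @^-1` pair_boxes I i j A B k) =
  X i @^-1` A `&` X j @^-1` B.
Proof.
rewrite !big_cons big_nil setIT /pair_boxes !eqxx.
apply/seteqP; split => [x [[/= Ai _] [_ Bj]]|x [/= Ai Bj]]; first by split.
split; split => //=; [by case: eqP => // ->|].
by case: eqP => // ->.
Qed.

Lemma mutually_independent2 (I : eqType) (X : I -> T -> R) i j :
  mutually_independent P X -> (forall k, measurable_fun setT (X k)) ->
  i != j -> independent2 P (X i) (X j).
Proof.
move=> XI mX ij A B mA mB.
have := XI [:: i; j] (pair_boxes I i j A B).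
rewrite /= inE ij => /(_ isT (fun k => measurable_pair_boxes I i j A B k mA mB)).
rewrite pair_boxesE !big_cons big_nil mulr1 /pair_boxes !eqxx.
rewrite (negbTE ij) eq_sym (negbTE ij) setIT setTI => E.
rewrite -[LHS]fineK ?fin_num_measure//; last first.
  by apply: measurableI; exact: measurable_preimage.
by rewrite E EFinM !fineK ?fin_num_measure//; exact: measurable_preimage.
Qed.

(** The indices within a pair may coincide, since [independent_families] allows repetitions in its
    lists; this covers squares of a single sample. *)
Lemma independent_families_pairs (I J : eqType) (X : I -> {mfun T >-> R})
    (Y : J -> {mfun T >-> R}) i1 i2 j1 j2 :
  independent_families P (fun i => X i : T -> R) (fun j => Y j : T -> R) ->
  independent2 P (pairRV (X i1) (X i2)) (pairRV (Y j1) (Y j2)).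
Proof.
move=> XY; apply: independent2_pairs => A1 A2 B1 B2 mA1 mA2 mB1 mB2.
have := XY [:: i1; i2] [:: j1; j2] (pair_boxes I i1 i2 A1 A2) (pair_boxes J j1 j2 B1 B2)
  (fun k => measurable_pair_boxes I i1 i2 A1 A2 k mA1 mA2)
  (fun k => measurable_pair_boxes J j1 j2 B1 B2 k mB1 mB2).
rewrite !pair_boxesE => E.
have mXA : measurable (X i1 @^-1` A1 `&` X i2 @^-1` A2).
  by apply: measurableI; exact: measurable_preimage.
have mYB : measurable (Y j1 @^-1` B1 `&` Y j2 @^-1` B2).
  by apply: measurableI; exact: measurable_preimage.
rewrite -[LHS]fineK ?fin_num_measure//; last exact: measurableI.
by rewrite E EFinM !fineK ?fin_num_measure.
Qed.

Lemma linear_pred_Dhat1 (C : (T -> R) -> Prop) n (X : int -> T -> R) t :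
  linear_pred C -> (forall i, C (X i)) -> C (Dhat n X t).
Proof.
move=> Clin CX; rewrite -[Dhat _ _ _]mulr1.
by apply: linear_pred_Dhat => // i; rewrite mulr1.
Qed.

Lemma linear_pred_Dhat2 (C : (T -> R) -> Prop) n m (X : int -> T -> R) s t :
  linear_pred C -> (forall i j, C (X i * X j)) -> C (Dhat n X s * Dhat m X t).
Proof.
move=> Clin CX; apply: linear_pred_Dhat => // i.
by rewrite mulrC; exact: linear_pred_Dhat.
Qed.

Lemma linear_pred_uncorrelated_r U : U \in L1 -> linear_pred (uncorrelated P U).
Proof.
move=> U1; have [C0 Clin] := linear_pred_uncorrelated P U U1.
split=> [|a f g Cf Cg]; apply: uncorrelatedC => //.
by apply: Clin; exact: uncorrelatedC.
Qed.

(** The delay [Lp] is only a time shift, so both forecasts fall under the results on [Dhat]. *)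
Lemma LhatE m Lp (X : int -> T -> R) t : Lhat m Lp X t = Dhat m X (t - Lp%:Z).
Proof.
apply/funext => x; rewrite /Lhat /Dhat; congr (_ * _).
by apply: eq_bigr => i _; rewrite addrAC.
Qed.

End Reduction.

(** * Variance of the order *)

Section OrderVariance.
Context {d : measure_display} {T : measurableType d} {R : realType}
  (P : probability T R) (D L : int -> T -> R) (muD v rho muL sL2 TNS : R)
  (n m Lp : nat).

Local Notation L1 := (Lfun P 1%E).
Local Notation Ex f := (fine ('E_P[f])%E).

Hypothesis rho_neq1 : rho != 1.
Hypothesis n_gt0 : (0 < n)%N.
Hypothesis m_gt0 : (0 < m)%N.
Hypothesis D1 : forall t, D t \in L1.
Hypothesis D2 : forall s t, D s * D t \in L1.
Hypothesis ED : forall t, Ex (D t) = muD.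
Hypothesis EDD : forall t (k : nat), Ex (D t * D (t - k%:Z)) = muD ^+ 2 + v * rho ^+ k.
Hypothesis Le1 : forall t, L t \in L1.
Hypothesis L2 : forall s t, L s * L t \in L1.
Hypothesis EL : forall t, Ex (L t) = muL.
(* White noise is the case [rho = 0] of the AR(1) autocovariance, as [0 ^+ 0 = 1]. *)
Hypothesis ELL : forall t (k : nat), Ex (L t * L (t - k%:Z)) = muL ^+ 2 + sL2 * 0 ^+ k.
Hypothesis LD : forall i k, uncorrelated P (L i) (D k).
Hypothesis LDD : forall i k l, uncorrelated P (L i) (D k * D l).
Hypothesis LLDD : forall i j k l, uncorrelated P (L i * L j) (D k * D l).

Let M t := Dhat m L t.
Let H t := Dhat n D t.

Let M1 t : M t \in L1.
Proof. by apply: (linear_pred_Dhat1 (fun f => f \in L1)) => //; exact: linear_pred_L1. Qed.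

Let H1 t : H t \in L1.
Proof. by apply: (linear_pred_Dhat1 (fun f => f \in L1)) => //; exact: linear_pred_L1. Qed.

Let M2 s t : M s * M t \in L1.
Proof. by apply: (linear_pred_Dhat2 (fun f => f \in L1)) => //; exact: linear_pred_L1. Qed.

Let H2 s t : H s * H t \in L1.
Proof. by apply: (linear_pred_Dhat2 (fun f => f \in L1)) => //; exact: linear_pred_L1. Qed.

Let HD s t : H s * D t \in L1.
Proof. by apply: (linear_pred_Dhat (fun f => f \in L1)) => //; exact: linear_pred_L1. Qed.

Let uncorr_MH s t : uncorrelated P (M s) (H t).
Proof.
apply: (linear_pred_Dhat1 (uncorrelated P ^~ (H t))) => [|i].
  exact: linear_pred_uncorrelated.
by apply: (linear_pred_Dhat1 (uncorrelated P _)) => //; exact: linear_pred_uncorrelated_r.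
Qed.

Let uncorr_MHD s t k : uncorrelated P (M s) (H t * D k).
Proof.
apply: (linear_pred_Dhat1 (uncorrelated P ^~ (H t * D k))) => [|i].
  exact: linear_pred_uncorrelated.
by apply: (linear_pred_Dhat (uncorrelated P _)) => //; exact: linear_pred_uncorrelated_r.
Qed.

Let uncorr_MMHH s s' t t' : uncorrelated P (M s * M s') (H t * H t').
Proof.
apply: (linear_pred_Dhat2 (uncorrelated P ^~ (H t * H t'))) => [|i j].
  exact: linear_pred_uncorrelated.
by apply: (linear_pred_Dhat2 (uncorrelated P _)) => //; exact: linear_pred_uncorrelated_r.
Qed.

Let h0 := muD ^+ 2 + v * (n%:R * (1 - rho ^+ 2) - 2 * rho * (1 - rho ^+ n)) /
  (n%:R * (1 - rho)) ^+ 2.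
Let h1 := h0 - v * (1 - rho ^+ n) / n%:R ^+ 2.

Let EHH t : Ex (H t * H t) = h0.
Proof. exact: Dhat_sqr. Qed.

Let EHH1 t : Ex (H t * H (t - 1)) = h1.
Proof. by rewrite (Dhat_consecutive P D muD v rho)// EHH. Qed.

Let EMM t : Ex (M t * M t) = muL ^+ 2 + sL2 / m%:R.
Proof.
rewrite (Dhat_sqr P L muL sL2 0)//; last by rewrite eq_sym oner_eq0.
by field; rewrite pnatr_eq0 -lt0n.
Qed.

Let EMM1 t : Ex (M t * M (t - 1)) = muL ^+ 2 + sL2 / m%:R - sL2 / m%:R ^+ 2.
Proof.
rewrite (Dhat_consecutive P L muL sL2 0)// EMM expr0n.
(* Positivity of [m] matters here: [0 ^+ m] would be 1 at [m = 0]. *)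
by rewrite eqn0Ngt m_gt0/= subr0 mulr1.
Qed.

Let EMH s t : Ex (M s * H t) = muL * muD.
Proof.
have [_ _ _ ->] := uncorr_MH s t.
by rewrite (mean_Dhat P L muL)// (mean_Dhat P D muD).
Qed.

(** Centring the last demand alone centres the order, because the two forecast products have the
    same mean. *)
Let W t := D t - cst muD.

Let HWE s t : H s * W t = (- muD) *: H s + H s * D t.
Proof. by apply/funext => x; rewrite /W !fctE /GRing.scale /=; ring. Qed.

Let uncorr_MHW s t k : uncorrelated P (M s) (H t * W k).
Proof.
rewrite HWE; have [_] := linear_pred_uncorrelated_r P (M s) (M1 s); exact.
Qed.

(** Consecutive forecasts have equal means, so the terms that come from centring cancel. *)
Let EHW_diff t : Ex (H t * W (t - 1)) - Ex (H (t - 1) * W (t - 1)) =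
  v * (1 - rho ^+ n) / n%:R.
Proof.
rewrite !HWE !expectation_linear//.
rewrite !(mean_Dhat P D muD)// opprD addrACA subrr add0r.
exact: (Dhat_recent_diff P D muD v rho).
Qed.

Let WWE t : W t * W t = (- (2 * muD)) *: D t + (D t * D t + cst (muD ^+ 2)).
Proof. by apply/funext => x; rewrite /W !fctE /GRing.scale /=; ring. Qed.

Let cst1 c : cst c \in L1. Proof. exact: Lfun_cst. Qed.

Let WW1 t : W t * W t \in L1.
Proof. by rewrite WWE; L1_closed. Qed.

Let EWW t : Ex (W t * W t) = v.
Proof.
rewrite WWE expectation_linear; [|by []|L1_closed].
rewrite ExD// ED expectation_cst/=.
by have := EDD t 0; rewrite subr0 => ->; ring.
Qed.

(* The square of [q - muD] is a sum of products of a lead-time monomial with a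
   demand monomial, so each expectation factors. *)
Lemma variance_order_q t :
  'V_P[order_q n m Lp TNS D L t] = (2 * (muL ^+ 2 + sL2 / m%:R) * h0
    - 2 * (muL ^+ 2 + sL2 / m%:R - sL2 / m%:R ^+ 2) * h1
    + 2 * muL * (v * (1 - rho ^+ n) / n%:R) + v)%:E.
Proof.
set s := t - Lp%:Z.
have qE : order_q n m Lp TNS D L t = M s * H t - M (s - 1) * H (t - 1) + D (t - 1).
  rewrite /order_q /order_up_to !LhatE -/s [t - 1 - _]addrAC -/s.
  by apply/funext => x; rewrite !fctE /M /H; ring.
have MH1 a b : M a * H b \in L1 by case: (uncorr_MH a b).
have Eq : Ex (order_q n m Lp TNS D L t) = muD.
  by rewrite qE ExD ?ExB ?EMH ?ED ?rpredB// subrr add0r.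
(* The scaled summands come first so that [expectation_linear] can strip them one by one. *)
have qqE : (order_q n m Lp TNS D L t \- cst muD) * (order_q n m Lp TNS D L t \- cst muD) =
    (- 2) *: ((M s * M (s - 1)) * (H t * H (t - 1)))
    + (2 *: (M s * (H t * W (t - 1)))
    + ((- 2) *: (M (s - 1) * (H (t - 1) * W (t - 1)))
    + ((M s * M s) * (H t * H t) + ((M (s - 1) * M (s - 1)) * (H (t - 1) * H (t - 1))
    + W (t - 1) * W (t - 1))))).
  by rewrite qE; apply/funext => x; rewrite /W !fctE /GRing.scale /=; ring.
have MHW1 a b c : M a * (H b * W c) \in L1 by case: (uncorr_MHW a b c).
have MMHH1 a b c e : (M a * M b) * (H c * H e) \in L1.
  by case: (uncorr_MMHH a b c e).
rewrite /variance covariance.unlock Eq qqE -[LHS]fineK; last first.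
  by apply: expectation_fin_num; L1_closed.
congr EFin.
do 3 (rewrite expectation_linear; [|L1_closed|L1_closed]).
rewrite ExD; [|L1_closed|L1_closed]; rewrite ExD//.
have EMMHH a b c e : Ex ((M a * M b) * (H c * H e)) = Ex (M a * M b) * Ex (H c * H e).
  by case: (uncorr_MMHH a b c e).
have EMHW a b c : Ex (M a * (H b * W c)) = muL * Ex (H b * W c).
  by case: (uncorr_MHW a b c) => _ _ _ ->; rewrite (mean_Dhat P L muL).
(* The two cross terms have opposite coefficients, so their difference [EHW_diff] suffices. *)
rewrite !EMMHH !EMHW EMM1 EHH1 !EMM !EHH EWW -(EHW_diff t); ring.
Qed.

End OrderVariance.

(** The variance regroups as [2 * (muL ^+ 2 + sL2 / m%:R) * (h0 - h1)], where [h0 - h1] is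
    [v * (1 - rho ^+ n) / n%:R ^+ 2], plus [2 * sL2 / m%:R ^+ 2 * h1] and the last two terms. *)
Lemma BM_formulaE (R : realType) (n m : nat) (muD rho s2 muL sL2 v : R) :
  (0 < n)%N -> (0 < m)%N -> rho != 1 -> v != 0 -> s2 / (1 - rho ^+ 2) = v ->
  let h0 := muD ^+ 2 + v * (n%:R * (1 - rho ^+ 2) - 2 * rho * (1 - rho ^+ n)) /
    (n%:R * (1 - rho)) ^+ 2 in
  let h1 := h0 - v * (1 - rho ^+ n) / n%:R ^+ 2 in
  (2 * (muL ^+ 2 + sL2 / m%:R) * h0
    - 2 * (muL ^+ 2 + sL2 / m%:R - sL2 / m%:R ^+ 2) * h1
    + 2 * muL * (v * (1 - rho ^+ n) / n%:R) + v) / v =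
  BM_formula n m muD rho s2 muL sL2.
Proof.
move=> n0 m0 r1 v0 vE h0 h1; rewrite /BM_formula vE /h1 /h0.
have nN0 : n%:R != 0 :> R by rewrite pnatr_eq0 -lt0n.
have mN0 : m%:R != 0 :> R by rewrite pnatr_eq0 -lt0n.
have r1N0 : 1 - rho != 0 by rewrite subr_eq0 eq_sym.
field.
by rewrite v0 nN0 mN0 r1N0.
Qed.

(** * From the hypotheses of the model to its moments and the bullwhip measure *)

Theorem theorem1 (d : measure_display) (T : measurableType d) (R : realType)
  (P : probability T R)
  (muD rho s2 : R) (eps D : int -> {RV P >-> R})
  (Lp : nat) (L : int -> {RV P >-> R}) (muL sL2 : R)
  (n m : nat) (TNS : R)
  (* AR(1) parameters *)
  (hrho : -1 < rho < 1) (hs2 : 0 < s2)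
  (* innovations: mean 0, variance s2, square integrable, identically distributed *)
  (heps_L2 : forall t, (eps t : T -> R) \in Lfun P 2%:E)
  (heps_mean : forall t, ('E_P[eps t] = 0)%E)
  (heps_var : forall t, 'V_P[eps t] = s2%:E)
  (heps_id : identically_distributed P (fun t => (eps t : T -> R)))
  (* lead times: values in {0,...,Lp}, mean muL, variance sL2, identically distributed *)
  (hL_vals : forall t x, exists k : nat, (k <= Lp)%N /\ L t x = k%:R)
  (hL_mean : forall t, ('E_P[L t] = muL%:E)%E)
  (hL_var : forall t, 'V_P[L t] = sL2%:E)
  (hL_id : identically_distributed P (fun t => (L t : T -> R)))
  (* (eps_t) i.i.d., (L_t) i.i.d., and (L_t) independent of (eps_t):
     the joint family {eps_t, L_s} is mutually independent *)
  (hindep : mutually_independent P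
              (eps_L_family (fun t => (eps t : T -> R)) (fun t => (L t : T -> R))))
  (* demand: stationary AR(1) process with finite second moments *)
  (hD_rec : forall t x, D t x = muD + rho * (D (t - 1) x - muD) + eps t x)
  (hD_L2 : forall t, (D t : T -> R) \in Lfun P 2%:E)
  (hD_stat_mean : forall t, ('E_P[D t] = 'E_P[D (0%R : int)])%E)
  (hD_stat_var : forall t, 'V_P[D t] = 'V_P[D 0])
  (* (L_t) is independent of (D_t) *)
  (hLD : independent_families P (fun t => (D t : T -> R)) (fun t => (L t : T -> R)))
  (hn : (0 < n)%N) (hm : (0 < m)%N) :
  (forall t s : int,
     'V_P[order_q n m Lp TNS (fun t => (D t : T -> R)) (fun t => (L t : T -> R)) t]
     = 'V_P[order_q n m Lp TNS (fun t => (D t : T -> R)) (fun t => (L t : T -> R)) s])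
  /\
  (forall t : int,
     ('V_P[order_q n m Lp TNS (fun t => (D t : T -> R)) (fun t => (L t : T -> R)) t]
       / 'V_P[D t])%E
     = (BM_formula n m muD rho s2 muL sL2)%:E).
Proof.
have L2L1 (f : T -> R) : f \in Lfun P 2%:E -> f \in Lfun P 1%E.
  by apply: Lfun_subset12; rewrite fin_num_measure.
have D1 t : (D t : T -> R) \in Lfun P 1%E by exact: L2L1.
have e1 t : (eps t : T -> R) \in Lfun P 1%E by exact: L2L1.
have D2 s t : (D s : T -> R) * (D t : T -> R) \in Lfun P 1%E.
  exact: Lfun2_mul_Lfun1.
have De1 s t : (D s : T -> R) * (eps t : T -> R) \in Lfun P 1%E.
  exact: Lfun2_mul_Lfun1.
have e2 s t : (eps s : T -> R) * (eps t : T -> R) \in Lfun P 1%E.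
  exact: Lfun2_mul_Lfun1.
(* Lead times are bounded by [Lp], which makes them and their products integrable. *)
have L_le t x : `|L t x| <= Lp%:R.
  by have [k [kL ->]] := hL_vals t x; rewrite normr_nat ler_nat.
have Le1 t : (L t : T -> R) \in Lfun P 1%E.
  by apply: bounded_L1 (L_le t); exact: measurable_funPT.
have L2 s t : (L s : T -> R) * (L t : T -> R) \in Lfun P 1%E.
  apply: (@bounded_L1 _ _ _ _ _ (Lp%:R * Lp%:R)).
    by apply: measurable_funM; exact: measurable_funPT.
  by move=> x; rewrite normrM ler_pM.
have eLm i : measurable_fun setT
    (eps_L_family (fun t => (eps t : T -> R)) (fun t => (L t : T -> R)) i).
  by case: i => t; exact: measurable_funPT.
have e_mean t : fine ('E_P[eps t])%E = 0 by rewrite heps_mean.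
have L_mean t : fine ('E_P[L t])%E = muL by rewrite hL_mean.
have ee s t : s != t -> fine ('E_P[(eps s : T -> R) * (eps t : T -> R)])%E = 0.
  move=> st.
  have := mutually_independent2 P _ _ (inl s) (inl t) hindep eLm st.
  by move=> /independent2_uncorrelated/(_ (e1 s) (e1 t))[_ _ _ ->]; rewrite e_mean mul0r.
have ee0 t : fine ('E_P[(eps t : T -> R) * (eps t : T -> R)])%E = s2.
  by rewrite (second_moment P _ s2)// e_mean expr0n add0r.
have LL t (k : nat) : fine ('E_P[(L t : T -> R) * (L (t - k%:Z)%R : T -> R)])%E =
    muL ^+ 2 + sL2 * 0 ^+ k.
  (* At lag 0 the factor [0 ^+ 0 = 1] retains the variance; at other lags independence applies. *)
  case: k => [|k]; first by rewrite subr0 (second_moment P _ sL2)// L_mean expr0 mulr1.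
  have tk : t != t - k.+1%:Z by rewrite eq_sym -subr_eq0 addrAC subrr add0r oppr_eq0.
  have := mutually_independent2 P _ _ (inr t) (inr (t - k.+1%:Z)) hindep eLm tk.
  move=> /independent2_uncorrelated/(_ (Le1 _) (Le1 _))[_ _ _ ->].
  by rewrite !L_mean expr0n mulr0 addr0 expr2.
have rec t : (D t : T -> R) =
    rho *: (D (t - 1) : T -> R) + ((eps t : T -> R) + cst ((1 - rho) * muD)).
  by apply/funext => x; rewrite hD_rec !fctE /GRing.scale /=; ring.
(* The stationary variance is still unknown here; [AR1_variance] determines it in [vs]. *)
pose v := fine 'V_P[D 0].
have vE t : 'V_P[D t] = v%:E by rewrite hD_stat_var /v fineK// variance_fin_num.
have D_const t : fine ('E_P[D t])%E = fine ('E_P[D 0%R])%E by rewrite hD_stat_mean.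
have DD_const t : fine ('E_P[(D t : T -> R) * (D t : T -> R)])%E =
    fine ('E_P[D 0%R])%E ^+ 2 + v.
  by rewrite (second_moment P _ v)// D_const.
have D_mean t : fine ('E_P[D t])%E = muD.
  exact: (AR1_mean P (fun t => D t : T -> R) (fun t => eps t : T -> R) muD rho).
have vs : (1 - rho ^+ 2) * v = s2.
  have := AR1_variance P (fun t => D t : T -> R) (fun t => eps t : T -> R)
    muD rho s2 _ hrho rec D1 e1 D2 De1 e2 e_mean ee ee0 D_const DD_const.
  by rewrite D_mean addrAC subrr add0r.
have DD t (k : nat) : fine ('E_P[(D t : T -> R) * (D (t - k%:Z)%R : T -> R)])%E =
    muD ^+ 2 + v * rho ^+ k.
  have := AR1_autocovariance P (fun t => D t : T -> R) (fun t => eps t : T -> R)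
    muD rho s2 _ hrho rec D1 e1 D2 De1 e2 e_mean ee ee0 D_const DD_const t k.
  by rewrite D_mean addrAC subrr add0r.
(* This independence of pairs yields [LD], [LDD] and [LLDD] on composing with projections or the
   product map. *)
have LDI i j k l : independent2 P (pairRV (L i) (L j)) (pairRV (D k) (D l)).
  exact/independent2C/(independent_families_pairs P _ _ D L).
pose prodR (z : R * R) : R := z.1 * z.2.
have mM : measurable_fun setT prodR by exact: measurable_funM.
have LD i k : uncorrelated P (L i) (D k).
  apply: independent2_uncorrelated => //.
  exact: (independent2_comp P _ _ fst fst _ _ (LDI i i k k)).
have LDD i k l : uncorrelated P (L i) ((D k : T -> R) * (D l : T -> R)).
  apply: independent2_uncorrelated => //.
  exact: (independent2_comp P _ _ fst prodR _ mM (LDI i i k l)).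
have LLDD i j k l :
    uncorrelated P ((L i : T -> R) * (L j : T -> R)) ((D k : T -> R) * (D l : T -> R)).
  apply: independent2_uncorrelated => //.
  exact: (independent2_comp P _ _ prodR prodR mM mM
    (LDI i j k l)).
have rho1 : rho != 1 by case/andP: hrho => _ /lt_eqF ->.
have rho2 : 1 - rho ^+ 2 != 0.
  rewrite (_ : _ - _ = (1 - rho) * (1 + rho)); last by ring.
  case/andP: hrho => rhoN1 rho_lt1.
  by rewrite mulf_neq0// gt_eqF//; lra.
have vE' : s2 / (1 - rho ^+ 2) = v by rewrite -vs mulrAC divff// mul1r.
have v0 : v != 0 by rewrite -vE' mulf_neq0// ?invr_eq0// gt_eqF.
have Vq := variance_order_q P (fun t => D t : T -> R) (fun t => L t : T -> R)
  muD v rho muL sL2 TNS n m Lp rho1 hn hm D1 D2 D_mean DD Le1 L2 L_mean LL LD LDD LLDD.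
split=> [t s|t]; first by rewrite !Vq.
(* The inverse on extended reals treats zero separately; [v0] selects the real quotient. *)
rewrite Vq vE inver (negbTE v0) -EFinM; congr EFin.
exact: BM_formulaE.
Qed.
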